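(* Let $T$ be an operator on a finite-dimensional Hilbert space $H$ with numerical radius at most $1$. Let $N \in \mathbb{N}$. Then there exist a finite-dimensional Hilbert space $K \supset H$ and a unitary operator $U$ on $K$ such that $$ T^n = 2 P_H U^n \big|_H \quad \text{ for } 1 \le n \le N. $$
   Context: The numerical radius of $T$ is $\sup\{ |\langle T\xi,\xi\rangle| : \xi \in H, \|\xi\|=1\}$. $K \supset H$ means $H$ is a subspace of $K$, and $P_H$ is the orthogonal projection onto $H$. *)

(* Defs.v *)
From HB Require Import structures.
From mathcomp Require Import all_boot all_order all_algebra sesquilinear.
From mathcomp Require Import classical_sets reals constructive_ereal ereal.
From mathcomp Require Export complex.

Set Implicit Arguments.
Unset Strict Implicit.
Unset Printing Implicit Defensive.

Import Order.TTheory GRing.Theory Num.Theory.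

Local Open Scope ring_scope.
Local Open Scope complex_scope.
Local Open Scope classical_set_scope.

(* A finite-dimensional Hilbert space is [H : vectType R[i]] with a form
   [f : {dot H for Num.conj}], linear in the first argument and
   conjugate-linear in the second one. *)
Section FinHilbert.
Context {R : realType} {H : vectType R[i]}.
Implicit Types (f : {dot H for Num.conj}) (T U : 'End(H)) (V : {vspace H}).

Definition hnorm f (x : H) : R := Num.sqrt (complex.Re (f x x)).

(* The supremum is taken in the extended reals, so it is the true supremum
   without a boundedness side condition; it is [-oo] exactly when H = 0. *)
Definition numerical_radius f T : \bar R :=
  ereal_sup [set (Normc.normc (f (T x) x))%:E | x in [set x : H | hnorm f x = 1]].

Definition unitary_op f U : Prop := isometry f f U /\ limg U = fullv.

Definition orth_proj f V : 'End(H) := daddv_pi V (orthov f V).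

End FinHilbert.

(* Main.v *)
(* If [w(T) <= 1], the block Toeplitz kernel with diagonal [1] and entries
   [T^(i-j)/2] below it is positive semidefinite on [H^(N+1)].  Indeed, with
   [y_j = sum_(i >= j) T^(i-j) x_i] one has [x_j = y_j - T y_(j+1)], and the
   quadratic form becomes [sum |y_j|^2 - Re sum <T y_(j+1), y_j>], which is
   nonnegative by averaging [|<T v, v>| <= |v|^2] over [v = sum_j w^j y_j], [w]
   running over roots of unity.  A finite-dimensional Gram space of this kernel
   carries isometric copies [h_0 = J, ..., h_N] of [H] with
   [<h_m x, h_0 y> = <T^m x, y>/2].  By the Toeplitz property the shift
   [h_i x |-> h_(i+1) x] preserves inner products, and since the Gram space is
   finite-dimensional it extends to a unitary operator [U]; then
   [U^m J = h_m] for [m <= N]. *)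
Require Import Defs.
From HB Require Import structures.
From mathcomp Require Import all_boot all_order all_algebra sesquilinear.
From mathcomp Require Import cyclic separable cyclotomic spectral ring.
From mathcomp Require Import classical_sets reals constructive_ereal ereal.
Import Order.TTheory GRing.Theory Num.Theory.
Local Open Scope ring_scope.

Set Implicit Arguments.
Unset Strict Implicit.
Unset Printing Implicit Defensive.
Local Open Scope sesquilinear_scope.

Section Dilation.
Variable C : numClosedFieldType.

(** * Roots of unity and their orthogonality *)

Lemma prim_root_exists n : (n > 0)%N -> exists z : C, n.-primitive_root z.
Proof.
move=> n_gt0; have [r] := closed_field_poly_normal ('X^n - 1 : {poly C}).
rewrite lead_coefXnsubC // scale1r => Xn1.
have /hasP[z _ pz] : has n.-primitive_root r; last by exists z.
(* Separability of ['X^n - 1] makes its [n] roots distinct, which forces one of them to be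
   primitive. *)
apply: has_prim_root => //.
- by apply/allP => z; rewrite -root_prod_XsubC -Xn1.
- by rewrite -separable_prod_XsubC -Xn1 separable_Xn_sub_1 // pnatr_eq0 -lt0n.
- by rewrite -ltnS -(size_prod_XsubC r id) -Xn1 size_XnsubC.
Qed.

Lemma norm_prim_root n (w : C) : n.-primitive_root w -> `|w| = 1.
Proof.
move=> pw; apply/eqP; rewrite -(pexpr_eq1 (prim_order_gt0 pw)) ?normr_ge0 //.
by rewrite -normrX (prim_expr_order pw) normr1.
Qed.

(** The summands are the powers of one [n]-th root of unity [z]: a geometric sum, which vanishes
    after multiplication by [z - 1] unless [z = 1]. *)
Lemma prim_root_orthogonality n (w : C) (a b : nat) : n.-primitive_root w ->
  \sum_(s < n) w ^+ (s * a) * (w ^+ (s * b))^* = (a == b %[mod n])%:R * n%:R.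
Proof.
move=> pw; have w1 := norm_prim_root pw.
pose z := w ^+ a * (w ^+ b)^*.
have E (s : 'I_n) : w ^+ (s * a) * (w ^+ (s * b))^* = z ^+ s.
  by rewrite /z exprMn -!exprM -rmorphXn -exprM !(mulnC s).
rewrite (eq_bigr _ (fun s _ => E s)).
have zE : (z == 1) = (a == b %[mod n]).
  rewrite -(eq_prim_root_expr pw) /z -(inj_eq (mulIf (_ : w ^+ b != 0))).
    by rewrite -mulrA [_^* * _]mulrC -normCK normrX w1 !expr1n mulr1 mul1r.
  by rewrite -normr_eq0 normrX w1 expr1n oner_eq0.
rewrite -zE; have [->|z1] := eqVneq z 1.
  under eq_bigr do rewrite expr1n.
  by rewrite sumr_const card_ord mul1r.
apply/eqP; rewrite mul0r -(mulrI_eq0 _ (lregP (_ : z - 1 != 0))) ?subr_eq0 //.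
have zn : z ^+ n = 1.
  rewrite exprMn -rmorphXn /= -!exprM ![(_ * n)%N]mulnC !exprM (prim_expr_order pw).
  by rewrite !expr1n rmorph1 mulr1.
by rewrite -subrX1 zn subrr.
Qed.

(** * Gram matrices and unitary equivalence *)

Lemma mulmx_dotmx m n (A : 'M[C]_(m, n)) i j :
  (A *m A^t*) i j = dotmx (row i A) (row j A).
Proof. by rewrite dotmxE !mxE; apply: eq_bigr => k _; rewrite !mxE. Qed.

(** By the spectral theorem [G] is [P^t* D P] with [D] diagonal and nonnegative, so [P^t*] times the
    square root of [D] serves as [S]. *)
Lemma psd_mx_factor n (G : 'M[C]_n) :
  G = G^t* -> (forall u : 'rV_n, 0 <= (u *m G *m u^t*) 0 0) ->
  exists S : 'M[C]_n, G = S *m S^t*.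
Proof.
move=> Gh Gp.
have /orthomx_spectralP : G \is normalmx by apply/normalmxP; rewrite -Gh.
set P := spectralmx G; set D := spectral_diag G => GE.
have Pu : P \is unitarymx := spectral_unitarymx G.
rewrite invmx_unitary // in GE.
have D_ge0 i : 0 <= D 0 i.
  (* Testing on row [i] of [P] isolates the eigenvalue [D 0 i]. *)
  have := Gp ('e_i *m P); rewrite trmx_mul map_mxM GE !mulmxA !mulmxtVK //.
  by rewrite trmx_delta map_delta_mx -rowE -colE !mxE eqxx mulr1n.
pose E : 'rV[C]_n := map_mx sqrtC D; exists (P^t* *m diag_mx E).
rewrite trmx_mul map_mxM trmxCK mulmxA [in LHS]GE; congr (_ *m _).
rewrite -mulmxA; congr (_ *m _); rewrite tr_diag_mx map_diag_mx mulmx_diag.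
congr diag_mx; apply/rowP => i; rewrite !mxE.
have /ger0_norm /= := D_ge0 i; rewrite -[D 0 i in LHS]sqrtCK normrX normCK.
by move=> ->.
Qed.

Lemma gram_vectors (I : finType) (g : I -> I -> C) :
  (forall i j, g i j = (g j i)^*) ->
  (forall c : I -> C, 0 <= \sum_i \sum_j c i * (c j)^* * g i j) ->
  exists n, exists k : I -> 'rV[C]_n, forall i j, dotmx (k i) (k j) = g i j.
Proof.
move=> gh gp; exists #|I|.
pose G : 'M[C]_#|I| := \matrix_(i, j) g (enum_val i) (enum_val j).
have [||S GE] := @psd_mx_factor _ G.
- by apply/matrixP => i j; rewrite !mxE.
- move=> u; have := gp (fun i => u 0 (enum_rank i)).
  rewrite mxE [X in _ <= X -> _]exchange_big (reindex _ (onW_bij _ (@enum_val_bij I))) /=.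
  congr (_ <= _); apply: eq_bigr => j _; rewrite !mxE mulr_suml.
  rewrite (reindex _ (onW_bij _ (@enum_val_bij I))) /=.
  by apply: eq_bigr => i _; rewrite !mxE !enum_valK mulrAC.
exists (fun i => row (enum_rank i) S) => i j.
by rewrite -mulmx_dotmx -GE mxE !enum_rankK.
Qed.

(** For rectangular matrices [unitarymx] means orthonormal rows. Gram-Schmidt on a basis of the
    orthogonal complement of the rows of [Q] gives [Z]. *)
Lemma unitarymx_complement r n (Q : 'M[C]_(r, n)) : Q \is unitarymx ->
  exists2 Z : 'M[C]_(n - r, n), Z \is unitarymx & Q *m Z^t* = 0.
Proof.
move=> Qu; pose Qo := orthomx Num.conj (mx_of_hermitian (hermitian1mx _)) Q.
have : exists2 Z : 'M[C]_(\rank Qo, n), Z \is unitarymx & Q *m Z^t* = 0.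
  exists (schmidt (row_base Qo)); first by rewrite schmidt_unitarymx ?rank_leq_col.
  apply/orthomx1P; rewrite orthomx_sym.
  by rewrite eqmx_schmidt_free ?row_base_free // eq_row_base.
by rewrite rank_ortho mxrank_unitary.
Qed.

(** Both orthonormal families are completed to bases, and [W] is the change of basis. *)
Lemma unitarymx_transitive r n (Q Q' : 'M[C]_(r, n)) :
  Q \is unitarymx -> Q' \is unitarymx ->
  exists2 W : 'M[C]_n, W \is unitarymx & Q *m W = Q'.
Proof.
move=> Qu Q'u; have le_rn : (r <= n)%N by rewrite -(mxrank_unitary Qu) rank_leq_col.
have [Z Zu QZ] := unitarymx_complement Qu.
have [Z' Z'u QZ'] := unitarymx_complement Q'u.
have colu (X : 'M[C]_(r, n)) (Y : 'M[C]_(n - r, n)) :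
  X \is unitarymx -> Y \is unitarymx -> X *m Y^t* = 0 -> col_mx X Y \is unitarymx.
  move=> Xu Yu XY; apply/unitarymxP; rewrite tr_col_mx map_row_mx mul_col_row.
  have -> : Y *m X^t* = 0 by rewrite -[Y]trmxCK -map_mxM -trmx_mul XY trmx0 map_mx0.
  by rewrite (unitarymxP Xu) (unitarymxP Yu) XY -scalar_mx_block.
have Mu := colu _ _ Qu Zu QZ; have M'u := colu _ _ Q'u Z'u QZ'.
exists ((col_mx Q Z)^t* *m col_mx Q' Z').
  apply/unitarymxP; rewrite trmx_mul map_mxM trmxCK mulmxA mulmxtVK //.
  by rewrite -[X in X *m _]mul1mx mulmxKtV // subnKC.
rewrite mulmxA tr_col_mx map_row_mx mul_mx_row (unitarymxP Qu) QZ.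
by rewrite mul_row_col mul1mx mul0mx addr0.
Qed.

(** Coefficients [X] that orthonormalise the rows of [A] do the same for [B], since only the Gram
    matrix enters. A unitary matching the two orthonormal families then carries [A] to [B]. *)
Lemma eq_gram_unitary_mx m n (A B : 'M[C]_(m, n)) :
  A *m A^t* = B *m B^t* -> exists2 W : 'M[C]_n, W \is unitarymx & A *m W = B.
Proof.
move=> AB.
have gram0 p (X : 'M[C]_(p, n)) : X *m X^t* = 0 -> X = 0.
  move=> X0; apply/row_matrixP => i; rewrite row0; apply/eqP.
  have /eqP : dotmx (row i X) (row i X) = 0 by rewrite -mulmx_dotmx X0 mxE.
  by rewrite dnorm_eq0.
(* Equal Gram matrices: [A] and [B] satisfy the same linear relations. *)
have transfer p (X : 'M[C]_(p, m)) : X *m A = 0 -> X *m B = 0.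
  move=> XA; apply: gram0; rewrite trmx_mul map_mxM mulmxA -(mulmxA X) -AB.
  by rewrite mulmxA XA !mul0mx.
pose Q := schmidt (row_base A).
have Qu : Q \is unitarymx by rewrite schmidt_unitarymx ?rank_leq_col.
have [X QE] : exists X, Q = X *m A.
  by apply/submxP; rewrite eqmx_schmidt_free ?row_base_free // eq_row_base.
have [Y AE] : exists Y, A = Y *m Q.
  by apply/submxP; rewrite eqmx_schmidt_free ?row_base_free // eq_row_base.
pose Q' := X *m B.
have Q'u : Q' \is unitarymx.
  apply/unitarymxP; rewrite -[RHS](unitarymxP Qu) QE !trmx_mul !map_mxM.
  by rewrite !mulmxA -(mulmxA X B) -(mulmxA X A) AB.
(* [1 - Y *m X] annihilates [A], hence also [B]. *)
have BE : B = Y *m Q'.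
  apply/eqP; rewrite -subr_eq0 /Q' mulmxA -[B in B - _]mul1mx -mulmxBl.
  by rewrite transfer // mulmxBl mul1mx -mulmxA -QE -AE subrr.
have [W Wu QW] := unitarymx_transitive Qu Q'u.
by exists W => //; rewrite AE -mulmxA QW -BE.
Qed.

Lemma eq_gram_unitary (I : finType) n (a b : I -> 'rV[C]_n) :
  (forall i j, dotmx (a i) (a j) = dotmx (b i) (b j)) ->
  exists2 W : 'M[C]_n, W \is unitarymx & forall i, a i *m W = b i.
Proof.
move=> ab; pose A := \matrix_(i < #|I|) a (enum_val i).
pose B := \matrix_(i < #|I|) b (enum_val i).
have [|W Wu AW] := @eq_gram_unitary_mx _ _ A B.
  by apply/matrixP => i j; rewrite !mulmx_dotmx !rowK ab.
exists W => // i; have /(congr1 (row (enum_rank i))) := AW.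
by rewrite row_mul !rowK enum_rankK.
Qed.

(** * Calculus of sesquilinear forms *)

Section DotForm.
Variables (H : lmodType C) (f : {dot H for Num.conj}).

Lemma dot_suml I (r : seq I) (P : pred I) (x : I -> H) z :
  f (\sum_(i <- r | P i) x i) z = \sum_(i <- r | P i) f (x i) z.
Proof. exact: linear_sumlz. Qed.

Lemma dot_sumr I (r : seq I) (P : pred I) (x : I -> H) z :
  f z (\sum_(i <- r | P i) x i) = \sum_(i <- r | P i) f z (x i).
Proof. exact: linear_sumr. Qed.

Lemma dotZl a x z : f (a *: x) z = a * f x z.
Proof. exact: linearZl_LR. Qed.

Lemma dotZr a x z : f z (a *: x) = a^* * f z x.
Proof. exact: linearZr_LR. Qed.

Lemma dotC x y : f x y = (f y x)^*.
Proof. by rewrite hermC mul1r. Qed.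

End DotForm.

(** * Positivity of the Toeplitz kernel *)

Section Toeplitz.
Variables (H : vectType C) (f : {dot H for Num.conj}) (T : 'End(H)).
Hypothesis Tle1 : forall x, `|f (T x) x| <= f x x.

(* Average [w^-s <T v_s, v_s>] over [v_s = sum_(i <= n) w^(s i) y_i], with [w] a
   primitive root of unity of order [n + 1].  The average is a cyclic sum, whose
   wrap-around term vanishes since [y n = 0]. *)
Lemma cyclic_shift_bound n (y : nat -> H) : y n = 0 ->
  `|\sum_(j < n) f (T (y j.+1)) (y j)| <= \sum_(j < n) f (y j) (y j).
Proof.
move=> yn0; pose M := n.+1.
have [w pw] := prim_root_exists (ltn0Sn n).
have w1 := norm_prim_root pw.
pose v s := \sum_(i < M) w ^+ (s * i) *: y i.
(* Used with [F] the identity for the norms and with [F = T] for the shifted sum. *)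
have fv (F : {linear H -> H}) s : f (F (v s)) (v s) =
    \sum_(i < M) \sum_(j < M) w ^+ (s * i) * (w ^+ (s * j))^* * f (F (y i)) (y j).
  rewrite /v [F _]linear_sum dot_suml; apply: eq_bigr => i _.
  rewrite dot_sumr; apply: eq_bigr => j _.
  by rewrite [F _]linearZ dotZl dotZr mulrA.
(* Averaging keeps the pairs with [a i = b j] modulo [M]: the diagonal for [id], [id], and the
   shifted diagonal [i = j + 1] for [id], [S]. *)
have avg (a b : nat -> nat) (g : nat -> nat -> C) :
    \sum_(s < M) \sum_(i < M) \sum_(j < M) w ^+ (s * a i) * (w ^+ (s * b j))^* * g i j
    = M%:R * \sum_(i < M) \sum_(j < M) (a i == b j %[mod M])%:R * g i j.
  rewrite exchange_big mulr_sumr; apply: eq_bigr => i _ /=.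
  rewrite exchange_big mulr_sumr; apply: eq_bigr => j _ /=.
  by rewrite -mulr_suml prim_root_orthogonality // mulrAC mulrC.
have normsum : \sum_(s < M) f (v s) (v s) = M%:R * \sum_(j < n) f (y j) (y j).
  rewrite (eq_bigr _ (fun (s : 'I_M) _ => fv (idfun : {linear H -> H}) s)) /=.
  apply: (etrans (avg id id (fun i j => f (y i) (y j)))); congr (_ * _).
  transitivity (\sum_(i < M) f (y i) (y i)).
    apply: eq_bigr => i _; rewrite (bigD1 i) //= eqxx mul1r big1 ?addr0 // => j ji.
    by rewrite !modn_small // eq_sym (negbTE (ji : val j != val i)) mul0r.
  by rewrite big_ord_recr /= yn0 linear0r addr0.
have shiftsum : \sum_(s < M) (w ^+ s)^* * f (T (v s)) (v s)
    = M%:R * \sum_(j < n) f (T (y j.+1)) (y j).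
  under eq_bigr => s _ do rewrite fv mulr_sumr.
  under eq_bigr => s _ do under eq_bigr => i _ do rewrite mulr_sumr.
  (* The twist by the conjugate of [w ^+ s] raises the exponent [s * j] to [s * j.+1]. *)
  under eq_bigr => s _ do under eq_bigr => i _ do under eq_bigr => j _ do
    rewrite mulrA mulrCA -rmorphM -exprD -mulnS.
  apply: (etrans (avg id S (fun i j => f (T (y i)) (y j)))); rewrite exchange_big; congr (_ * _).
  rewrite big_ord_recr /= [X in _ + X]big1 => [|i _]; last first.
    by rewrite yn0 linear0r mulr0.
  rewrite addr0; apply: eq_bigr => j _.
  rewrite (bigD1 (lift ord0 j)) //= eqxx mul1r big1 ?addr0 // => i ij.
  rewrite !modn_small //; last exact: ltn_ord j.
  by rewrite (negbTE (ij : val i != j.+1)) mul0r.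
have M0 : 0 < M%:R :> C by rewrite ltr0n.
(* After scaling by [M], the triangle inequality reduces the claim to [Tle1] at each [v s]. *)
rewrite -(ler_pM2l M0) -normsum.
rewrite -[M%:R in leLHS]ger0_norm ?ler0n // -normrM -shiftsum.
apply: le_trans (ler_norm_sum _ _ _) _; apply: ler_sum => s _.
by rewrite normrM norm_conjC normrX w1 expr1n mul1r.
Qed.

(* [toeplitz] is the Hermitian part of this lower triangular kernel, so its diagonal
   is [f] while its off-diagonal entries carry a factor [1/2]. *)
Definition toeplitz_half (i j : nat) (x y : H) : C :=
  (j <= i)%:R * f (iter (i - j) T x) y.

Definition toeplitz (i j : nat) (x y : H) : C :=
  (toeplitz_half i j x y + (toeplitz_half j i y x)^*) / 2.

Lemma toeplitz_ge0 n (x : nat -> H) :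
  0 <= \sum_(i < n) \sum_(j < n) toeplitz i j (x i) (x j).
Proof.
pose y j := \sum_(i < n) (j <= i)%:R *: iter (i - j) T (x i).
have yn0 : y n = 0.
  by rewrite /y big1 // => i _; rewrite leqNgt ltn_ord scale0r.
have xE (j : 'I_n) : x j = y j - T (y j.+1).
  rewrite /y linear_sum -sumrB (bigD1 j) //= leqnn subnn scale1r.
  rewrite ltnn scale0r linear0 subr0 big1 ?addr0 // => i ij.
  rewrite linearZ; case: (ltngtP j i) => [ji|ji|/val_inj ji] /=.
  - by rewrite -iterS subnSK // subrr.
  - by rewrite !scale0r subrr.
  - by rewrite ji eqxx in ij.
pose a := \sum_(i < n) \sum_(j < n) toeplitz_half i j (x i) (x j).
pose q := \sum_(j < n) f (y j) (y j).
pose b := \sum_(j < n) f (T (y j.+1)) (y j).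
(* Summing over [i] first gives the sum of [f (y j) (x j)]; the [T] term of [x j] sits in the second
   argument, hence the conjugate of [b]. *)
have aE : a = q - b^*.
  rewrite /a exchange_big /q /b rmorph_sum -sumrB; apply: eq_bigr => j _ /=.
  rewrite -dotC -linearB -xE -[RHS]/(f (y j) (x j)) dot_suml; apply: eq_bigr => i _.
  by rewrite dotZl.
have -> : \sum_(i < n) \sum_(j < n) toeplitz i j (x i) (x j) = (a + a^*) / 2.
  rewrite /toeplitz; under eq_bigr do rewrite -mulr_suml big_split /=.
  rewrite -mulr_suml big_split /=; congr ((_ + _) / _).
  rewrite exchange_big rmorph_sum; apply: eq_bigr => i _.
  by rewrite rmorph_sum.
have q_real : q^* = q.
  rewrite /q rmorph_sum; apply: eq_bigr => j _; exact/esym/dotC.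
have -> : (a + a^*) / 2 = q - 'Re b.
  by rewrite aE rmorphB /= conjCK q_real ReE; field.
by rewrite subr_ge0 (le_trans (leif_Re_Creal b)) // cyclic_shift_bound.
Qed.

Lemma toeplitzC i j x y : toeplitz i j x y = (toeplitz j i y x)^*.
Proof.
rewrite /toeplitz [RHS]rmorphM /= rmorphD /= conjCK fmorphV rmorph_nat.
by rewrite [_ + toeplitz_half i j x y]addrC.
Qed.

(** This invariance is what makes the shift of Gram vectors isometric. *)
Lemma toeplitzSS i j x y : toeplitz i.+1 j.+1 x y = toeplitz i j x y.
Proof. by rewrite /toeplitz /toeplitz_half !subSS !ltnS. Qed.

Lemma toeplitz00 x y : toeplitz 0 0 x y = f x y.
Proof.
by rewrite /toeplitz /toeplitz_half /= !mul1r -dotC; field.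
Qed.

(** Strictly below the diagonal only one triangular half contributes; the remaining [1/2] is what
    the factor 2 of the dilation compensates. *)
Lemma toeplitzS0 n x y : toeplitz n.+1 0 x y = f (iter n.+1 T x) y / 2.
Proof. by rewrite /toeplitz /toeplitz_half /= mul1r mul0r conjC0 addr0. Qed.

(** * Expansion in a basis and the dilation on row vectors *)

Lemma iter_lincomb n d (c : 'I_d -> C) (e : 'I_d -> H) :
  iter n T (\sum_a c a *: e a) = \sum_a c a *: iter n T (e a).
Proof.
elim: n => [|n IHn] //; rewrite iterS IHn linear_sum; apply: eq_bigr => a _.
by rewrite linearZ.
Qed.

Lemma toeplitz_half_lincomb i j d (c c' : 'I_d -> C) (e : 'I_d -> H) :
  toeplitz_half i j (\sum_a c a *: e a) (\sum_b c' b *: e b) =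
  \sum_a \sum_b c a * (c' b)^* * toeplitz_half i j (e a) (e b).
Proof.
rewrite /toeplitz_half iter_lincomb dot_suml mulr_sumr; apply: eq_bigr => a _.
rewrite dot_sumr mulr_sumr; apply: eq_bigr => b _.
by rewrite dotZl dotZr [RHS]mulrCA -[in RHS]mulrA.
Qed.

Lemma toeplitz_lincomb i j d (c c' : 'I_d -> C) (e : 'I_d -> H) :
  toeplitz i j (\sum_a c a *: e a) (\sum_b c' b *: e b) =
  \sum_a \sum_b c a * (c' b)^* * toeplitz i j (e a) (e b).
Proof.
rewrite /toeplitz !toeplitz_half_lincomb.
have -> : (\sum_a \sum_b c' a * (c b)^* * toeplitz_half j i (e a) (e b))^* =
    \sum_a \sum_b c a * (c' b)^* * (toeplitz_half j i (e b) (e a))^*.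
  rewrite exchange_big rmorph_sum; apply: eq_bigr => a _ /=.
  rewrite rmorph_sum; apply: eq_bigr => b _ /=.
  by rewrite !rmorphM /= conjCK [X in X * _]mulrC.
rewrite -big_split mulr_suml; apply: eq_bigr => a _ /=.
rewrite -big_split mulr_suml; apply: eq_bigr => b _ /=.
by rewrite -mulrDr mulrA.
Qed.

Lemma unitary_half_dilation N :
  exists n, exists h : {linear H -> 'rV[C]_n}, exists2 W : 'M[C]_n, W \is unitarymx &
    (forall x y, dotmx (h x) (h y) = f x y) /\
    forall m x y, (0 < m <= N)%N ->
      dotmx (iter m (mulmxr W) (h x)) (h y) = f (iter m T x) y / 2.
Proof.
pose d := \dim {:H}; pose e (a : 'I_d) : H := (vbasis {:H})`_a.
have eE x : x = \sum_a coord (vbasis {:H}) a x *: e a.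
  exact: coord_vbasis (memvf x).
(* Restricting the kernel to basis vectors makes its index set finite. *)
pose g (p q : 'I_N.+1 * 'I_d) := toeplitz p.1 q.1 (e p.2) (e q.2).
have [||n [k kE]] := @gram_vectors _ g.
- by move=> p q; exact: toeplitzC.
- move=> c; pose x i := \sum_a c (inord i, a) *: e a.
  have pairS (F : 'I_N.+1 * 'I_d -> C) : \sum_p F p = \sum_i \sum_a F (i, a).
    by rewrite pair_bigA; apply: eq_bigr => -[].
  have := toeplitz_ge0 N.+1 x; congr (_ <= _).
  rewrite pairS; apply: eq_bigr => i _; under [RHS]eq_bigr do rewrite pairS.
  rewrite exchange_big; apply: eq_bigr => j _; rewrite toeplitz_lincomb.
  by rewrite !inord_val.
(* Linear extension of the Gram vectors at level [m]; [inord m] is faithful only for [m <= N],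
   whence the bounds in [hE]. *)
pose h m x := \sum_a coord (vbasis {:H}) a x *: k (inord m, a).
have h_lin m : linear (h m).
  move=> a x y; rewrite /h scaler_sumr -big_split; apply: eq_bigr => b _ /=.
  by rewrite linearP scalerDl scalerA.
have hE i j x y : (i <= N)%N -> (j <= N)%N -> dotmx (h i x) (h j y) = toeplitz i j x y.
  move=> iN jN; rewrite [in RHS](eE x) [in RHS](eE y) toeplitz_lincomb.
  rewrite /h (dot_suml (@dotmx C n)); apply: eq_bigr => a _.
  rewrite (dot_sumr (@dotmx C n)); apply: eq_bigr => b _.
  by rewrite (dotZl (@dotmx C n)) (dotZr (@dotmx C n)) mulrA [X in _ * X]kE /g /= !inordK.
(* Only levels below [N] are shifted, so that both families stay within the [N + 1] available
   levels. *)
have [W Wu kW] : exists2 W : 'M[C]_n, W \is unitarymx & forall p : 'I_N * 'I_d,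
    k (inord p.1, p.2) *m W = k (inord p.1.+1, p.2).
  apply: eq_gram_unitary => p q; rewrite !kE /g /= !inordK ?toeplitzSS //;
    by [exact: ltn_ord | exact: leqW (ltn_ord _)].
have hW i x : (i < N)%N -> h i x *m W = h i.+1 x.
  move=> iN; rewrite /h mulmx_suml; apply: eq_bigr => a _.
  by rewrite -scalemxAl (kW (Ordinal iN, a)).
have hiter m x : (m <= N)%N -> iter m (mulmxr W) (h 0%N x) = h m x.
  elim: m => // m IHm mN; rewrite iterS IHm /= ?hW //; exact: ltnW.
pose h0_lin := GRing.isLinear.Build _ _ _ _ (h 0%N) (h_lin 0%N).
pose h0 : {linear H -> 'rV[C]_n} := HB.pack (h 0%N) h0_lin.
exists n, h0, W => //=.
split=> [x y|m x y /andP[m0 mN]]; first by rewrite hE // toeplitz00.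
by rewrite hiter // hE //; case: m m0 {mN} => // m _; rewrite toeplitzS0.
Qed.

End Toeplitz.

End Dilation.

Local Open Scope complex_scope.

(** * From the numerical radius to a bound on the quadratic form *)

Section NumericalRadius.
Context {R : realType} {H : vectType R[i]}.
Variables (dotH : {dot H for Num.conj}) (T : 'End(H)).

Lemma numerical_radius_le1_dnorm :
  (numerical_radius dotH T <= 1%:E)%E ->
  forall x, `|dotH (T x) x| <= dotH x x.
Proof.
move=> wT x; have [->|x0] := eqVneq x 0.
  by rewrite linear0 linear0r normr0.
have xx_gt0 : 0 < dotH x x by rewrite dnorm_gt0.
have xxE : dotH x x = (complex.Re (dotH x x))%:C.
  by rewrite RRe_real // realE ltW.
set r := complex.Re (dotH x x) in xxE.
have r0 : 0 < r by rewrite xxE ltcR in xx_gt0.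
(* The inverse of the norm of [x]: the supremum is tested at the unit vector [a x]. *)
set a : R := (Num.sqrt r)^-1.
have a2 : a * a = r^-1 by rewrite -invfM -expr2 sqr_sqrtr // ltW.
have aC : (a%:C)^* = a%:C :> R[i] by rewrite conjc_real.
(* Needed for [y = x], to see that [a x] has norm 1, and for [y = T x]. *)
have scal y : dotH y x / dotH x x = dotH (a%:C *: y) (a%:C *: x).
  by rewrite dotZl dotZr [Num.conj _]aC mulrA -rmorphM a2 xxE fmorphV mulrC.
have normcE' z : (Normc.normc z)%:C = `|z| :> R[i] by case: z => b c; rewrite normc_def.
have : Normc.normc (dotH (T (a%:C *: x)) (a%:C *: x)) <= 1.
  rewrite -lee_fin; apply: le_trans wT; apply: ereal_sup_ubound.
  exists (a%:C *: x) => //=.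
  by rewrite /hnorm -scal divff ?gt_eqF //= Num.Theory.sqrtr1.
rewrite [T _]linearZ -scal -lecR normcE' normrM.
by rewrite normfV (gtr0_norm xx_gt0) ler_pdivrMr // mul1r.
Qed.

End NumericalRadius.

(** * Assembly of the dilation and computation of the projection *)

Theorem corollary4p9 (R : realType) (H : vectType R[i])
    (dotH : {dot H for Num.conj}) (T : 'End(H)) (N : nat) :
  (numerical_radius dotH T <= 1%:E)%E ->
  exists (K : vectType R[i]) (dotK : {dot K for Num.conj})
         (J : 'Hom(H, K)) (U : 'End(K)),
    [/\ isometry dotK dotH J, unitary_op dotK U &
        forall n : nat, (1 <= n <= N)%N -> forall x : H,
          J (iter n T x) = 2 *: orth_proj dotK (limg J) (iter n U (J x))].
Proof.
move=> /numerical_radius_le1_dnorm /(@unitary_half_dilation _ _ _ _)/(_ N).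
move=> [n [h [W Wu [h_iso hW]]]].
exists 'rV[R[i]]_n, (@dotmx _ n), (linfun h), (linfun (mulmxr W)).
have iterU m u : iter m (linfun (mulmxr W)) u = iter m (mulmxr W) u.
  by apply: eq_iter => v; rewrite lfunE.
split.
- by move=> x y; rewrite !lfunE; exact: h_iso.
- split.
    move=> u v; rewrite !lfunE /= !dotmxE trmx_mul map_mxM mulmxA mulmxtVK //.
  apply/vspaceP => v; rewrite memvf.
  have -> : v = linfun (mulmxr W) (v *m invmx W).
    by rewrite lfunE /= mulmxKV // unitarymx_unit.
  exact: memv_img (memvf _).
move=> m mN x; rewrite iterU (lfunE h x).
set u := iter m (mulmxr W) _; set V := limg _.
(* Positive definiteness makes the sum of [V] and its orthogonal complement direct, as the
   projection lemmas require. *)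
have VV : (V :&: orthov (@dotmx _ n) V = 0)%VS.
  apply/eqP; rewrite -subv0; apply/subvP => v.
  rewrite memv_cap memv0 => /andP[vV /mem_orthovP vo].
  by rewrite -(dnorm_eq0 (@dotmx _ n)) vo.
(* The expected projection of [u]: it lies in [V], and [hW] makes [u - v] orthogonal to [V]. *)
pose v := linfun h (2^-1 *: iter m T x).
have vV : v \in V by exact: memv_img (memvf _).
have uvo : u - v \in orthov (@dotmx _ n) V.
  apply/mem_orthovP => _ /memv_imgP[y _ ->].
  rewrite lfunE linearBl /v lfunE; apply/eqP; rewrite subr_eq0; apply/eqP.
  by rewrite [LHS]hW // [RHS]h_iso dotZl mulrC.
have -> : orth_proj (@dotmx _ n) V u = v.
  rewrite /orth_proj -[u](subrK v) linearD /= (daddv_pi_id VV vV).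
  have uv_sum : u - v \in (V + orthov (@dotmx _ n) V)%VS.
    by apply: (subvP (addvSr _ _)).
  (* The complementary projection fixes [u - v], so the projection onto [V] kills it. *)
  have := daddv_pi_add VV uv_sum; rewrite [X in _ + X]daddv_pi_id 1?capvC //.
  by move/(canRL (addrK _)); rewrite subrr => ->; rewrite add0r.
by rewrite /v !lfunE /= linearZ scalerA divff ?scale1r.
Qed.
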